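(* If $g$ is a saturated graph grid diagram then $\partial_g^-\circ\partial_g^-=0$.
   Context: A graph grid diagram $g$ is an $n\times n$ grid of squares, each empty or containing an $X$ or an $O$, with some $O$'s decorated by $*$, such that: exactly one $O$ lies in each row and each column; if a row (column) does not contain exactly one $X$ then the $O$ in that row (column) is decorated by $*$; each class of the equivalence relation on the $X$'s and $O$'s generated by sharing a row or column contains a decorated $O$. It is saturated if each row and each column contains at least one $X$. $\mathbb{X}$ and $\mathbb{O}=\{O_1,\dots,O_n\}$ denote the sets of $X$'s and $O$'s, viewed as points at the centres of their squares. Identify opposite sides of the grid to get an oriented torus $\mathcal{T}$ with horizontal circles $\alpha_1,\dots,\alpha_n$ and vertical circles $\beta_1,\dots,\beta_n$ (the grid lines). $\mathbf{S}$ is the set of $\mathbf{x}=\{x_i\}_{i=1}^n$ with $x_i\in\alpha_i\cap\beta_{\sigma(i)}$ for a permutation $\sigma\in S_n$. Let $\mathbb{F}=\mathbb{Z}/2\mathbb{Z}$, $R_n=\mathbb{F}[U_1,\dots,U_n]$, and let $C^-(g)$ be the free $R_n$-module generated by $\mathbf{S}$. If $\mathbf{x},\mathbf{y}\in\mathbf{S}$ differ in exactly two points, $\mathrm{Rect}(\mathbf{x},\mathbf{y})$ is the set (of two elements) of embedded rectangles $r\subset\mathcal{T}$ with sides on the $\alpha$ and $\beta$ circles, with corners the points where $\mathbf{x},\mathbf{y}$ differ, whose horizontal sides, with the boundary orientation of $\partial r$, run from points of $\mathbf{x}$ to points of $\mathbf{y}$; otherwise $\mathrm{Rect}(\mathbf{x},\mathbf{y})=\emptyset$.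 $\mathrm{Rect}^o(\mathbf{x},\mathbf{y})$ consists of those $r$ with $\mathrm{Int}(r)\cap\mathbf{x}=\emptyset$. $O_i(r)$ is $1$ if $O_i\in r$ and $0$ otherwise. The map $\partial_g^-:C^-(g)\to C^-(g)$ is the $R_n$-module homomorphism with $$\partial_g^-(\mathbf{x})=\sum_{\mathbf{y}\in\mathbf{S}}\ \sum_{r\in\mathrm{Rect}^o(\mathbf{x},\mathbf{y}),\ \mathrm{Int}(r)\cap\mathbb{X}=\emptyset}U_1^{O_1(r)}\cdots U_n^{O_n(r)}\,\mathbf{y}.$$ *)

(* Defs.v *)
From HB Require Import structures.
From mathcomp Require Import all_boot all_order all_algebra all_fingroup.
From mathcomp Require Import mpoly.

Set Implicit Arguments.
Unset Strict Implicit.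
Unset Printing Implicit Defensive.

Import GRing.Theory.
Local Open Scope ring_scope.

(* Rows are numbered upwards and columns rightwards.  The same pairs (i, j)
   also index the points of the intersections of the circles on the torus:
   (i, j) as a point is alpha_i :&: beta_j, the lower left corner of the
   square (i, j). *)
Definition square (n : nat) : finType := ('I_n * 'I_n)%type.
Definition point (n : nat) : finType := ('I_n * 'I_n)%type.

Section Markings.
Variables (n : nat) (X : {set square n}) (O : 'I_n -> square n).

Definition marked : {set square n} := X :|: [set O k | k : 'I_n].

Definition share_line : rel (square n) :=
  fun p q => [&& p \in marked, q \in marked & (p.1 == q.1) || (p.2 == q.2)].

End Markings.

(* The O's come with an arbitrary numbering, and the decorated ones are given
   by their indices.  As share_line is symmetric, its reflexive transitive
   closure connect is the equivalence relation it generates. *)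
Record graph_grid (n : nat) := GraphGrid {
  gridX : {set square n};
  gridO : 'I_n -> square n;
  starred : {set 'I_n};
  gridXO : forall k, gridO k \notin gridX;
  gridO_row : forall i : 'I_n, #|[set k | (gridO k).1 == i]| = 1%N;
  gridO_col : forall j : 'I_n, #|[set k | (gridO k).2 == j]| = 1%N;
  gridX_row : forall k : 'I_n,
    #|[set p in gridX | p.1 == (gridO k).1]| != 1%N -> k \in starred;
  gridX_col : forall k : 'I_n,
    #|[set p in gridX | p.2 == (gridO k).2]| != 1%N -> k \in starred;
  grid_class : forall p : square n, p \in marked gridX gridO ->
    exists2 k, k \in starred & connect (share_line gridX gridO) p (gridO k)
}.

Definition saturated (n : nat) (g : graph_grid n) : Prop :=
  (forall i : 'I_n, exists2 p, p \in gridX g & p.1 = i) /\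
  (forall j : 'I_n, exists2 p, p \in gridX g & p.2 = j).

Definition state (n : nat) : finType := 'S_n.

Definition points (n : nat) (x : state n) : {set point n} :=
  [set (i, x i) | i : 'I_n].

(* Number of steps from a to i in the positive direction of the cycle Z/n. *)
Definition steps (n : nat) (a i : 'I_n) : nat := ((i + n - a) %% n)%N.

(* Circles strictly between a and b, and lines of squares between them, when
   going from a to b in the positive direction. *)
Definition open_arc (n : nat) (a b i : 'I_n) : bool :=
  (0 < steps a i < steps a b)%N.
Definition arc_cells (n : nat) (a b i : 'I_n) : bool :=
  (steps a i < steps a b)%N.

(* ((a, b), (c, d)) is the rectangle going up from alpha_a to alpha_b and
   right from beta_c to beta_d, possibly across the boundary of the grid. *)
Definition rectangle (n : nat) : finType :=
  {r : ('I_n * 'I_n) * ('I_n * 'I_n) | (r.1.1 != r.1.2) && (r.2.1 != r.2.2)}.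

Section Rectangles.
Variables (n : nat) (r : rectangle n).

Definition bot : 'I_n := (val r).1.1.
Definition top : 'I_n := (val r).1.2.
Definition lft : 'I_n := (val r).2.1.
Definition rgt : 'I_n := (val r).2.2.

Definition corners : {set point n} :=
  [set (bot, lft); (bot, rgt); (top, rgt); (top, lft)].

Definition interior_points : {set point n} :=
  [set p | open_arc bot top p.1 & open_arc lft rgt p.2].

Definition squares_in : {set square n} :=
  [set p | arc_cells bot top p.1 & arc_cells lft rgt p.2].

End Rectangles.

(* The boundary is oriented counterclockwise, so the bottom side runs from
   (bot, lft) to (bot, rgt) and the top side from (top, rgt) to (top, lft). *)
Definition Rect (n : nat) (x y : state n) : {set rectangle n} :=
  [set r | [&& #|points x :\: points y| == 2,
               corners r == (points x :\: points y) :|: (points y :\: points x),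
               ((bot r, lft r) \in points x) && ((bot r, rgt r) \in points y) &
               ((top r, rgt r) \in points x) && ((top r, lft r) \in points y)]].

Definition Recto (n : nat) (x y : state n) : {set rectangle n} :=
  [set r in Rect x y | [disjoint interior_points r & points x]].

Definition Ocount (n : nat) (g : graph_grid n) (k : 'I_n) (r : rectangle n) :
  nat := gridO g k \in squares_in r.

Definition Rn (n : nat) := {mpoly 'F_2[n]}.

(* R_n^o makes R_n a module over itself rather than over 'F_2. *)
Definition Cminus (n : nat) : lmodType (Rn n) := {ffun state n -> (Rn n)^o}.

Definition gen (n : nat) (y : state n) : Cminus n :=
  [ffun z => (z == y)%:R : (Rn n)^o].

Definition weight (n : nat) (g : graph_grid n) (r : rectangle n) : Rn n :=
  \prod_(k < n) 'X_k ^+ Ocount g k r.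

Definition dminus_gen (n : nat) (g : graph_grid n) (x : state n) : Cminus n :=
  \sum_(y : state n)
    \sum_(r in Recto x y | [disjoint squares_in r & gridX g])
      weight g r *: gen y.

Definition dminus (n : nat) (g : graph_grid n) (c : Cminus n) : Cminus n :=
  \sum_(x : state n) ((c : {ffun state n -> (Rn n)^o}) x : Rn n) *: dminus_gen g x.

Fact dminus_is_linear (n : nat) (g : graph_grid n) : linear (dminus g).
Proof.
move=> a c d; rewrite /dminus scaler_sumr -big_split; apply: eq_bigr => x _.
by rewrite /= !ffunE scalerDl scalerA.
Qed.

HB.instance Definition _ (n : nat) (g : graph_grid n) :=
  GRing.isLinear.Build (Rn n) (Cminus n) (Cminus n) _ (dminus g)
    (dminus_is_linear g).

Fact dminus_on_gen (n : nat) (g : graph_grid n) (x : state n) :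
  dminus g (gen x) = dminus_gen g x.
Proof.
rewrite /dminus (bigD1 x) //= ffunE eqxx scale1r big1 ?addr0 // => y /negPf yx.
by rewrite ffunE yx scale0r.
Qed.

(* Main.v *)
Require Import Defs.
From mathcomp Require Import all_boot all_order all_algebra all_fingroup.
From mathcomp Require Import mpoly zify ring.

Set Implicit Arguments.
Unset Strict Implicit.
Unset Printing Implicit Defensive.

Import GRing.Theory.
Local Open Scope ring_scope.

(** The coefficient of a state z in the square of the differential, applied to
    a state x, is a sum over pairs of consecutive empty X-free rectangles
    leading from x to z.  A fixed-point-free involution pairs these off,
    preserving the weight, so the sum vanishes in characteristic 2
    ([big_involution]).

    A rectangle starting at x is determined by the ordered pair (a, b) of its
    bottom and top rows: its left and right sides lie on the circles x a and
    x b, and it leads to x with its values at a and b exchanged.  A pair of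
    consecutive rectangles is thus a quadruple of rows ((a, b), (c, d)).
    - If {a, b} and {c, d} are disjoint, the rectangles can be performed in the
      other order.
    - If they share one row, emptiness forces the union to be an embedded
      hexagon.  It has one reflex corner, and cutting it there horizontally or
      vertically gives its two decompositions into rectangles; the involution
      exchanges them.
    - If {a, b} = {c, d}, the union is a full horizontal or vertical annulus.
      It contains a row or a column of squares, hence an X by saturation, so
      such pairs do not occur ([legal2_no_annulus]).

    In the first two cases the new pair covers every square as often as the old
    one, so the weight and the avoidance of X are preserved at once.  So is
    emptiness, by an argument that needs no case distinction.  Let n_w(D) be
    the sum, over the points of a state w, of the multiplicities of D in the
    four squares around the point.  For a rectangle r from x to y, both n_x(r)
    and n_y(r) equal 2 plus 4 times the number of points of x inside r.  For r
    from x to y followed by r' from y to z one has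
    n_y(r) - n_z(r) = n_x(r') - n_y(r') ([vertex_sum_exchange]), so
    n_x(r + r') + n_z(r + r') = 2 n_x(r) + 2 n_y(r'), and both rectangles are
    empty exactly if this number, which depends only on x, z and the sum of the
    two rectangles, is at most 8 ([empty2E]). *)

(** * Arcs of the cyclic order *)

Section Arcs.
Variable n : nat.
Implicit Types a b c d i : 'I_n.

Definition cyc a b c : bool := (a < b < c)%N || (b < c < a)%N || (c < a < b)%N.

Lemma cyc_permE a b c : a != b -> b != c -> a != c ->
  (cyc b c a = cyc a b c) * (cyc c a b = cyc a b c) *
  (cyc a c b = ~~ cyc a b c) * (cyc b a c = ~~ cyc a b c) *
  (cyc c b a = ~~ cyc a b c).
Proof. rewrite -!val_eqE /= => ab bc ac; do !split; rewrite /cyc; lia. Qed.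

Lemma cyc_neq a b c : cyc a b c -> [/\ a != b, b != c & a != c].
Proof.
by move=> abc; rewrite -!val_eqE /=; split; move: abc; rewrite /cyc; lia.
Qed.

Lemma stepsE a i : steps a i = if (a <= i)%N then (i - a)%N else (i + n - a)%N.
Proof.
have lti := ltn_ord i; have lta := ltn_ord a.
rewrite /steps; case: leqP => le_ai; last by rewrite modn_small //; lia.
have -> : (i + n - a = (i - a) + n)%N by lia.
by rewrite modnDr modn_small //; lia.
Qed.

Lemma arc_cellsE a b i :
  arc_cells a b i = (a <= i < b)%N || (i < b < a)%N || (b < a <= i)%N.
Proof.
have lti := ltn_ord i; have lta := ltn_ord a; have ltb := ltn_ord b.
rewrite /arc_cells !stepsE; case: (leqP a i) => ?; case: (leqP a b) => ?; lia.
Qed.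

Lemma open_arcE a b i : open_arc a b i = cyc a i b.
Proof.
have lti := ltn_ord i; have lta := ltn_ord a; have ltb := ltn_ord b.
rewrite /open_arc !stepsE /cyc.
case: (leqP a i) => ?; case: (leqP a b) => ?; lia.
Qed.

Lemma arc_cells_pred a b i : arc_cells a b (ord_pred i) =
  (a < i <= b)%N || (b < a < i)%N || (i <= b < a)%N.
Proof.
have lti := ltn_ord i; have lta := ltn_ord a; have ltb := ltn_ord b.
have pE : nat_of_ord (ord_pred i) = if i == 0 :> nat then n.-1 else i.-1.
  rewrite /=; case: eqP => [->|/eqP i0]; first by rewrite add0n modn_small; lia.
  have -> : ((i + n).-1 = i.-1 + n)%N by lia.
  by rewrite modnDr modn_small //; lia.
rewrite arc_cellsE pE; case: eqP; lia.
Qed.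

Lemma arc_cellsD a b c i : cyc a b c ->
  (arc_cells a b i + arc_cells b c i)%N = arc_cells a c i.
Proof. rewrite /cyc !arc_cellsE; lia. Qed.

Lemma arc_cells_cover a b i : a != b -> arc_cells a b i || arc_cells b a i.
Proof. rewrite -val_eqE /= !arc_cellsE; lia. Qed.

Lemma arc_cells_start a b : a != b -> arc_cells a b a.
Proof. rewrite -val_eqE /= !arc_cellsE; lia. Qed.

(** Number of cells of the arc from a to b that are adjacent to the circle i;
    for distinct a and b it is 2 inside the arc, 1 at its ends and 0 outside. *)
Definition density a b i : int :=
  (arc_cells a b i)%:Z + (arc_cells a b (ord_pred i))%:Z.

Lemma density_ends a b : a != b -> density a b a = 1 /\ density a b b = 1.
Proof. rewrite -val_eqE /= /density !arc_cells_pred !arc_cellsE; lia. Qed.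

Lemma density_interior a b i : i != a -> i != b ->
  density a b i = 2 * (open_arc a b i)%:Z.
Proof.
rewrite -!val_eqE /= /density arc_cells_pred arc_cellsE open_arcE /cyc; lia.
Qed.

(** Up to a constant depending on a and b only, the density of the arc from a to
    b at i is sg (i - a) - sg (i - b).  The difference of its values at c and d
    is therefore a combination of the signs of the four differences between a
    or b and c or d, and these are odd. *)
Lemma density_jump a b c d : a != b -> c != d ->
  density a b c - density a b d = - (density c d a - density c d b).
Proof.
rewrite -!val_eqE /=.
pose sg (i j : 'I_n) : int := (j < i)%N%:Z - (i < j)%N%:Z.
have dE (u v i : 'I_n) : (u : nat) != v ->
    density u v i = sg i u - sg i v + 2 * (v < u)%N%:Z.
  rewrite /sg /density arc_cells_pred arc_cellsE; lia.
move=> ab cd; rewrite !dE // /sg; lia.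
Qed.

End Arcs.

(** * Rectangles leaving a state, and pairs of consecutive ones *)

Section Juxtapositions.
Variable n : nat.
Implicit Types (x y : state n) (p : 'I_n * 'I_n)
  (q : ('I_n * 'I_n) * ('I_n * 'I_n)).

(** The state at which the rectangle of rows p leaving x arrives. *)
Definition flip x p : state n := (tperm p.1 p.2 * x)%g.

(** The rectangle from x with bottom row p.1 and top row p.2 has its left and
    right sides on x p.1 and x p.2, because its lower left and upper right
    corners are points of x. *)
Definition covers x p (s : square n) : bool :=
  arc_cells p.1 p.2 s.1 && arc_cells (x p.1) (x p.2) s.2.

Definition empty_from x p : bool :=
  [forall i, ~~ (open_arc p.1 p.2 i && open_arc (x p.1) (x p.2) (x i))].

Lemma flipL x a b : flip x (a, b) a = x b.
Proof. by rewrite permM tpermL. Qed.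

Lemma flipR x a b : flip x (a, b) b = x a.
Proof. by rewrite permM tpermR. Qed.

Lemma flipD x a b i : i != a -> i != b -> flip x (a, b) i = x i.
Proof. by move=> ia ib; rewrite permM tpermD // eq_sym. Qed.

Definition flip2 x q : state n := flip (flip x q.1) q.2.

Definition cover2 x q (s : square n) : nat :=
  covers x q.1 s + covers (flip x q.1) q.2 s.

Definition proper q : bool := (q.1.1 != q.1.2) && (q.2.1 != q.2.2).

Definition empty2 x q : bool :=
  empty_from x q.1 && empty_from (flip x q.1) q.2.

(** * Emptiness is determined by the domain covered *)

Definition around (f : square n -> nat) (i j : 'I_n) : int :=
  (f (i, j))%:Z + (f (ord_pred i, j))%:Z + (f (i, ord_pred j))%:Z
  + (f (ord_pred i, ord_pred j))%:Z.

Definition vertex_sum (f : square n -> nat) x : int :=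
  \sum_i around f i (x i).

Lemma vertex_sum_covers x p y : vertex_sum (covers x p) y =
  \sum_i density p.1 p.2 i * density (x p.1) (x p.2) (y i).
Proof.
apply: eq_bigr => i _; rewrite /around /covers /density /=.
do 4 case: arc_cells => //=.
Qed.

(** On a function with separated variables, exchanging two values of a state
    changes the sum by a product of two one-dimensional differences. *)
Lemma vertex_sum_flip (H K : 'I_n -> int) x a b : a != b ->
  \sum_i H i * K (x i) - \sum_i H i * K (flip x (a, b) i) =
  (H a - H b) * (K (x a) - K (x b)).
Proof.
move=> ab; rewrite -sumrB (bigD1 a) //= (bigD1 b) 1?eq_sym //= big1.
  by rewrite flipL flipR; ring.
by move=> i /andP[ia ib]; rewrite flipD // subrr.
Qed.

(** The two corners of the rectangle lying on x contribute 1 each, and a point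
    of x in the interior contributes 4.  No other point contributes, since a
    state has one point on each circle and so none elsewhere on the sides. *)
Lemma vertex_sum_start x p : p.1 != p.2 -> vertex_sum (covers x p) x =
  2 + 4 * (\sum_i (open_arc p.1 p.2 i && open_arc (x p.1) (x p.2) (x i)))%N%:Z.
Proof.
case: p => a b /= ab; have xab : x a != x b by rewrite (inj_eq perm_inj).
have [[ha hb] [ka kb]] := (density_ends ab, density_ends xab).
rewrite vertex_sum_covers /= (bigD1 a) //= (bigD1 b) 1?eq_sym //=.
rewrite ha hb ka kb [in RHS](bigD1 a) //= [in RHS](bigD1 b) 1?eq_sym //=.
rewrite !open_arcE.
have -> : cyc a a b = false by rewrite /cyc; lia.
have -> : cyc a b b = false by rewrite /cyc; lia.
rewrite !add0n (raddf_sum Posz) mulr_sumr addrA; congr (_ + _).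
apply: eq_bigr => i /andP[ia ib].
rewrite !density_interior ?(inj_eq perm_inj) // !open_arcE.
by case: cyc; case: cyc.
Qed.

Lemma vertex_sum_end x p : p.1 != p.2 ->
  vertex_sum (covers x p) (flip x p) = vertex_sum (covers x p) x.
Proof.
case: p => a b /= ab; have [ha hb] := density_ends ab.
apply/esym/eqP; rewrite -subr_eq0 !vertex_sum_covers /=.
by rewrite vertex_sum_flip // ha hb subrr mul0r.
Qed.

Lemma empty_fromE x p : p.1 != p.2 ->
  empty_from x p = (vertex_sum (covers x p) x <= 2)%R.
Proof.
move=> pp; rewrite vertex_sum_start //.
apply/forallP/idP => [e|le i].
  by rewrite big1 // => i _; rewrite (negbTE (e i)).
apply: contraTN le => ei; rewrite (bigD1 i) //= ei; lia.
Qed.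

Lemma vertex_sum_ge2 x p : p.1 != p.2 -> (2 <= vertex_sum (covers x p) x)%R.
Proof. by move=> pp; rewrite vertex_sum_start //; lia. Qed.

(** Each side is a product of a difference of row densities and a difference of
    column densities.  Interchanging the roles of the two rectangles negates
    both factors, by [density_jump]. *)
Lemma vertex_sum_exchange x q : proper q ->
  vertex_sum (covers x q.1) (flip x q.1) - vertex_sum (covers x q.1) (flip2 x q)
  = vertex_sum (covers (flip x q.1) q.2) x
    - vertex_sum (covers (flip x q.1) q.2) (flip x q.1).
Proof.
case: q => [[a b] [c d]] /andP[/= ab cd]; rewrite /flip2 !vertex_sum_covers /=.
set y := flip x (a, b).
rewrite !vertex_sum_flip //.
rewrite (density_jump ab cd) (density_jump (a := x a)) ?(inj_eq perm_inj) //.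
ring.
Qed.

Lemma vertex_sum_cover2 x q y : vertex_sum (cover2 x q) y =
  vertex_sum (covers x q.1) y + vertex_sum (covers (flip x q.1) q.2) y.
Proof.
rewrite -big_split; apply: eq_bigr => i _.
rewrite /around /cover2 /= !PoszD; ring.
Qed.

(** The right-hand side involves the two rectangles only through their common
    domain and the state they lead to, so emptiness carries over to any other
    decomposition of the same domain. *)
Lemma empty2E x q : proper q -> empty2 x q =
  (vertex_sum (cover2 x q) x + vertex_sum (cover2 x q) (flip2 x q) <= 8)%R.
Proof.
move=> pq; have exch := vertex_sum_exchange x pq; have /andP[pq1 pq2] := pq.
have e1 := vertex_sum_end x pq1; have e2 := vertex_sum_end (flip x q.1) pq2.
have g1 := vertex_sum_ge2 x pq1; have g2 := vertex_sum_ge2 (flip x q.1) pq2.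
rewrite /empty2 !empty_fromE // !vertex_sum_cover2.
rewrite -/(flip2 x q) in e2.
lia.
Qed.

Definition same_composite x q q' : Prop :=
  flip2 x q = flip2 x q' /\ cover2 x q =1 cover2 x q'.

Lemma same_composite_sym x q q' :
  same_composite x q q' -> same_composite x q' q.
Proof. by case=> eqz eqD; split=> // s; rewrite eqD. Qed.

Lemma empty2_same x q q' : proper q -> proper q' -> same_composite x q q' ->
  empty2 x q = empty2 x q'.
Proof.
move=> pq pq' [eqz eqD]; rewrite !empty2E // eqz.
have eqV y : vertex_sum (cover2 x q) y = vertex_sum (cover2 x q') y.
  by apply: eq_bigr => i _; rewrite /around !eqD.
by rewrite !eqV.
Qed.

(** * The two decompositions of a domain *)

Lemma flip2_conj x a b c d : flip2 x ((a, b), (c, d)) =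
  flip2 x ((tperm a b c, tperm a b d), (a, b)).
Proof.
by rewrite /flip2 /flip /= !mulgA; congr (_ * x)%g; rewrite conjgC tpermJ.
Qed.

Lemma same_composite_disjoint x a b c d :
  c != a -> c != b -> d != a -> d != b ->
  same_composite x ((a, b), (c, d)) ((c, d), (a, b)).
Proof.
move=> ca cb da db; split=> [|s].
  by rewrite flip2_conj !tpermD // 1?eq_sym.
by rewrite /cover2 /covers /= !flipD // 1?eq_sym // addnC.
Qed.

(** The next four lemmas compare the two ways of cutting an L-shaped hexagon at
    its reflex corner.  The circles of rows a, b, c and of their columns bound a
    block of two by two cells, and the hexagon is this block without its upper
    right, lower right, upper left or lower left cell respectively.  The covers
    agree because the row arc from a to c and the longest column arc are each
    the sum of two consecutive arcs, and covers are bilinear in the arcs. *)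
Lemma same_composite_hex_ur x a b c : cyc a b c -> cyc (x a) (x c) (x b) ->
  same_composite x ((a, b), (b, c)) ((a, c), (a, b)).
Proof.
move=> abc col; have [ab bc ac] := cyc_neq abc.
split=> [|s]; first by rewrite flip2_conj tpermR tpermD.
rewrite /cover2 /covers /= !(flipL, flipR) !flipD // 1?eq_sym // -!mulnb.
by rewrite -(arc_cellsD _ abc) -(arc_cellsD _ col); ring.
Qed.

Lemma same_composite_hex_lr x a b c : cyc a b c -> cyc (x a) (x b) (x c) ->
  same_composite x ((a, b), (b, c)) ((b, c), (a, c)).
Proof.
move=> abc col; have [ab bc ac] := cyc_neq abc.
split=> [|s].
  by rewrite [RHS]flip2_conj tpermR (tpermD (z := a)) // eq_sym.
rewrite /cover2 /covers /= !(flipL, flipR) !flipD // 1?eq_sym // -!mulnb.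
by rewrite -(arc_cellsD _ abc) -(arc_cellsD _ col); ring.
Qed.

Lemma same_composite_hex_ul x a b c : cyc a b c -> cyc (x a) (x b) (x c) ->
  same_composite x ((b, c), (a, b)) ((a, b), (a, c)).
Proof.
move=> abc col; have [ab bc ac] := cyc_neq abc.
split=> [|s]; first by rewrite [RHS]flip2_conj tpermL tpermD.
rewrite /cover2 /covers /= !(flipL, flipR) !flipD // 1?eq_sym // -!mulnb.
by rewrite -(arc_cellsD _ abc) -(arc_cellsD _ col); ring.
Qed.

Lemma same_composite_hex_ll x a b c : cyc a b c -> cyc (x b) (x a) (x c) ->
  same_composite x ((b, c), (a, b)) ((a, c), (b, c)).
Proof.
move=> abc col; have [ab bc ac] := cyc_neq abc.
split=> [|s].
  by rewrite flip2_conj tpermL tpermD // eq_sym.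
rewrite /cover2 /covers /= !(flipL, flipR) !flipD // 1?eq_sym // -!mulnb.
by rewrite -(arc_cellsD _ abc) -(arc_cellsD _ col); ring.
Qed.

Lemma empty_fromP x a b i :
  empty_from x (a, b) -> ~~ (cyc a i b && cyc (x a) (x i) (x b)).
Proof. by move/forallP/(_ i); rewrite !open_arcE. Qed.

(** The next four lemmas treat the four ways in which two rectangles can share
    exactly one row.  They then abut along a horizontal circle or along a
    vertical one, and in the wrong cyclic order across that circle they would
    overlap around the torus.  Whichever way the other coordinates are ordered,
    either the first rectangle would contain the point of x on the row that only
    the second one uses, or the second would contain the point of the
    intermediate state on the row that only the first one uses. *)
Lemma empty2_order_up x a b c : a != b -> b != c -> a != c ->
  empty2 x ((a, b), (b, c)) -> cyc a b c.
Proof.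
move=> ab bc ac /andP[/(empty_fromP c) /= e1 /(empty_fromP a)].
rewrite flipL flipR flipD // 1?eq_sym //; move: e1.
rewrite !(cyc_permE ab bc ac) !(@cyc_permE _ (x a) (x b) (x c)).
  by do 2 case: cyc.
all: by rewrite (inj_eq perm_inj).
Qed.

Lemma empty2_order_down x a b c : a != b -> b != c -> a != c ->
  empty2 x ((b, c), (a, b)) -> cyc a b c.
Proof.
move=> ab bc ac /andP[/(empty_fromP a) /= e1 /(empty_fromP c)].
rewrite flipL flipR flipD //; move: e1.
rewrite !(cyc_permE ab bc ac) !(@cyc_permE _ (x a) (x b) (x c)).
  by do 2 case: cyc.
all: by rewrite (inj_eq perm_inj).
Qed.

Lemma empty2_order_right x a b c : a != b -> b != c -> a != c ->
  empty2 x ((a, b), (a, c)) -> cyc (x a) (x b) (x c).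
Proof.
move=> ab bc ac /andP[/(empty_fromP c) /= e1 /(empty_fromP b)].
rewrite flipL flipR flipD // 1?eq_sym //; move: e1.
rewrite !(cyc_permE ab bc ac) !(@cyc_permE _ (x a) (x b) (x c)).
  by do 2 case: cyc.
all: by rewrite (inj_eq perm_inj).
Qed.

Lemma empty2_order_left x a b c : a != b -> b != c -> a != c ->
  empty2 x ((b, c), (a, c)) -> cyc (x a) (x b) (x c).
Proof.
move=> ab bc ac /andP[/(empty_fromP a) /= e1 /(empty_fromP b)].
rewrite flipL flipR flipD //; move: e1.
rewrite !(cyc_permE ab bc ac) !(@cyc_permE _ (x a) (x b) (x c)).
  by do 2 case: cyc.
all: by rewrite (inj_eq perm_inj).
Qed.

(** The four outer tests tell which row is shared, that is, whether the second
    rectangle lies above, below, to the right or to the left of the first one.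
    The inner test tells which of the two rectangles is the longer one along
    their common side, which decides on the position of the reflex corner. *)
Definition alternate x q :=
  let: ((a, b), (c, d)) := q in
  if c == b then
    if cyc (x a) (x b) (x d) then ((b, d), (a, d)) else ((a, d), (a, b))
  else if d == a then
    if cyc (x c) (x a) (x b) then ((c, a), (c, b)) else ((c, b), (a, b))
  else if c == a then
    if cyc a b d then ((b, d), (a, b)) else ((a, d), (d, b))
  else if d == b then
    if cyc c a b then ((c, a), (a, b)) else ((c, b), (a, c))
  else ((c, d), (a, b)).

Definition partners x q q' : Prop :=
  [/\ proper q', same_composite x q q', alternate x q' = q & q' != q].

Lemma alternateP x q : proper q ->
  q.2 != q.1 -> q.2 != (q.1.2, q.1.1) -> empty2 x q ->
  partners x q (alternate x q).
Proof.
case: q => [[a b] [c d]] /andP[/= ab cd].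
rewrite !xpair_eqE => nq nq' emp; rewrite /alternate.
have xneq i j : i != j -> x i != x j by rewrite (inj_eq perm_inj).
have [cb|cb] := eqVneq c b.
  move: cd nq nq' emp; rewrite {}cb eqxx /= => bd _; rewrite eq_sym => ad emp.
  have abd := empty2_order_up ab bd ad emp.
  have da : d != a by rewrite eq_sym.
  have ba : b != a by rewrite eq_sym.
  have db : d != b by rewrite eq_sym.
  case: ifP => col.
    split; first by rewrite /proper /= bd ad.
    - exact: same_composite_hex_lr.
    - by rewrite /= (negbTE ad) (negbTE db) (negbTE ab) eqxx abd.
    - by rewrite !xpair_eqE (negbTE ba).
  have {}col : cyc (x a) (x d) (x b).
    by rewrite !(@cyc_permE _ (x a) (x b) (x d)) ?xneq // col.
  split; first by rewrite /proper /= ad.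
  - exact: same_composite_hex_ur.
  - rewrite /= (negbTE ad) (negbTE ba) eqxx.
    by rewrite !(cyc_permE ab bd ad) abd.
  - by rewrite !xpair_eqE (negbTE db) andbF.
have [da|da] := eqVneq d a.
  move: cd nq nq' emp; rewrite {}da => ca _ _ emp.
  have rows := empty2_order_down ca ab cb emp.
  have ac : a != c by rewrite eq_sym.
  have ba : b != a by rewrite eq_sym.
  have bc : b != c by rewrite eq_sym.
  case: ifP => col.
    split; first by rewrite /proper /= ca cb.
    - exact: same_composite_hex_ul.
    - by rewrite /= (negbTE ca) (negbTE bc) eqxx rows.
    - by rewrite !xpair_eqE (negbTE ca).
  have {}col : cyc (x a) (x c) (x b).
    by rewrite !(@cyc_permE _ (x c) (x a) (x b)) ?xneq // col.
  split; first by rewrite /proper /= cb ab.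
  - exact: same_composite_hex_ll.
  - rewrite /= (negbTE ab) (negbTE bc) (negbTE ac) eqxx.
    by rewrite !(cyc_permE ca ab cb) rows.
  - by rewrite !xpair_eqE (negbTE ca).
have [ca|ca] := eqVneq c a.
  move: cd cb nq nq' emp; rewrite {}ca eqxx /= => ad _ db _ emp.
  have bd : b != d by rewrite eq_sym.
  have ba : b != a by rewrite eq_sym.
  have col := empty2_order_right ab bd ad emp.
  case: ifP => row.
    split; first by rewrite /proper /= bd ab.
    - by apply/same_composite_sym/same_composite_hex_ul.
    - by rewrite /= (negbTE ad) eqxx col.
    - by rewrite !xpair_eqE (negbTE ba).
  have {}row : cyc a d b by rewrite !(cyc_permE ab bd ad) row.
  split; first by rewrite /proper /= ad db.
  - by apply/same_composite_sym/same_composite_hex_ur.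
  - rewrite /= eqxx.
    by rewrite !(@cyc_permE _ (x a) (x b) (x d)) ?xneq // col.
  - by rewrite !xpair_eqE (negbTE db) andbF.
have [db|db] := eqVneq d b.
  move: cd da nq nq' emp; rewrite {}db => _ ba _ _ emp.
  have ac : a != c by rewrite eq_sym.
  have bc : b != c by rewrite eq_sym.
  have col := empty2_order_left ca ab cb emp.
  case: ifP => row.
    split; first by rewrite /proper /= ca ab.
    - by apply/same_composite_sym/same_composite_hex_lr.
    - by rewrite /= eqxx col.
    - by rewrite !xpair_eqE (negbTE ca).
  have {}row : cyc a c b by rewrite !(cyc_permE ca ab cb) row.
  split; first by rewrite /proper /= cb ac.
  - by apply/same_composite_sym/same_composite_hex_ll.
  - rewrite /= (negbTE ab) eqxx.
    by rewrite !(@cyc_permE _ (x c) (x a) (x b)) ?xneq // col.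
  - by rewrite !xpair_eqE (negbTE ca).
split; first by rewrite /proper /= cd ab.
- exact: same_composite_disjoint.
- have [ad bc ac bd] : [/\ a != d, b != c, a != c & b != d].
    by split; rewrite eq_sym.
  by rewrite /= (negbTE ad) (negbTE bc) (negbTE ac) (negbTE bd).
- by rewrite !xpair_eqE (negbTE ca).
Qed.

End Juxtapositions.

(** * Rectangles counted by the differential *)

Section Legal.
Variables (n : nat) (g : graph_grid n).
Implicit Types (x y : state n) (p : 'I_n * 'I_n)
  (q : ('I_n * 'I_n) * ('I_n * 'I_n)).

Definition legal x p : bool :=
  [&& p.1 != p.2, empty_from x p & [forall s in gridX g, ~~ covers x p s]].

Definition legal2 x q : bool := legal x q.1 && legal (flip x q.1) q.2.

Definition Oweight x p : Rn n := \prod_(k < n) 'X_k ^+ covers x p (gridO g k).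

Lemma legal2E x q : legal2 x q =
  [&& proper q, empty2 x q & [forall s in gridX g, cover2 x q s == 0%N]].
Proof.
rewrite /legal2 /legal /proper /empty2.
have -> : [forall s in gridX g, cover2 x q s == 0%N] =
    [forall s in gridX g, ~~ covers x q.1 s] &&
    [forall s in gridX g, ~~ covers (flip x q.1) q.2 s].
  apply/forall_inP/andP=> [h|[/forall_inP h1 /forall_inP h2] s sX].
    by split; apply/forall_inP => s /h; rewrite addn_eq0 !eqb0 => /andP[].
  by rewrite addn_eq0 !eqb0 h1 // h2.
by rewrite -!andbA; do !bool_congr.
Qed.

Lemma legal2_same x q q' : proper q' -> same_composite x q q' ->
  legal2 x q -> legal2 x q'.
Proof.
move=> pq' qq'; rewrite !legal2E pq' /= => /and3P[pq emp free].
rewrite -(empty2_same pq pq' qq') emp /=.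
by apply/forall_inP=> s /(forall_inP free); rewrite qq'.2.
Qed.

(** Repeating the rows (a, b) adds a rectangle on the complementary column arc,
    which completes a horizontal annulus; using (b, a) adds one on the
    complementary row arc, which completes a vertical annulus. *)
Lemma legal2_no_annulus x q : saturated g -> legal2 x q ->
  q.2 != q.1 /\ q.2 != (q.1.2, q.1.1).
Proof.
case: q => [[a b] [c d]] [Xrow Xcol].
rewrite legal2E => /and3P[/andP[/= ab _] _ /forall_inP free].
have xab : x a != x b by rewrite (inj_eq perm_inj).
split; apply/eqP => -[ca db]; subst c d.
- have [[i j] sX /= ia] := Xrow a; subst i.
  have := free _ sX; rewrite /cover2 /covers /= flipL flipR arc_cells_start //=.
  by have := arc_cells_cover j xab; do 2 case: arc_cells.
- have [[i j] sX /= jx] := Xcol (x a); subst j.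
  have := free _ sX; rewrite /cover2 /covers /= flipL flipR arc_cells_start //.
  by rewrite !andbT; have := arc_cells_cover i ab; do 2 case: arc_cells.
Qed.

Lemma alternate_legal x q : saturated g -> legal2 x q ->
  partners x q (alternate x q) /\ legal2 x (alternate x q).
Proof.
move=> sat leg; have [neq neq'] := legal2_no_annulus sat leg.
have /and3P[pq emp _] : [&& proper q, empty2 x q &
  [forall s in gridX g, cover2 x q s == 0%N]] by rewrite -legal2E.
have part := alternateP pq neq neq' emp; split=> //.
by case: part => pq' qq' _ _; apply: legal2_same leg.
Qed.

Lemma Oweight2 x q : Oweight x q.1 * Oweight (flip x q.1) q.2 =
  \prod_(k < n) 'X_k ^+ cover2 x q (gridO g k).
Proof. by rewrite -big_split; apply: eq_bigr => k _; rewrite exprD. Qed.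

(** * The differential as a sum over pairs of rows *)

Lemma in_points x i j : ((i, j) \in points x) = (x i == j).
Proof.
apply/imsetP/eqP => [[k _ [-> ->]]|<-] //; by exists i.
Qed.

Lemma RectE x y (r : rectangle n) : (r \in Rect x y) =
  [&& x (bot r) == lft r, x (top r) == rgt r & y == flip x (bot r, top r)].
Proof.
have bt : bot r != top r by have /andP[] := valP r.
rewrite inE !in_points; apply/idP/idP.
  case/and4P=> _ /eqP cor /andP[/eqP xb /eqP yb] /andP[/eqP xt /eqP yt].
  rewrite xb xt !eqxx; apply/eqP/permP => i.
  have [->|ib] := eqVneq i (bot r); first by rewrite flipL yb.
  have [->|it] := eqVneq i (top r); first by rewrite flipR yt.
  rewrite flipD //; apply/eqP; apply: contraT => yx.
  have : (i, x i) \in corners r by rewrite cor !inE !in_points eqxx yx.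
  by rewrite !inE !xpair_eqE (negbTE ib) (negbTE it).
case/and3P=> /eqP xb /eqP xt /eqP ->.
have lr : lft r != rgt r by have /andP[] := valP r.
have D1 : points x :\: points (flip x (bot r, top r)) =
    [set (bot r, lft r); (top r, rgt r)].
  apply/setP=> -[i j]; rewrite !inE !in_points !xpair_eqE.
  have [->|ib] := eqVneq i (bot r).
    rewrite flipL xb xt (negbTE bt) /= orbF andbC (eq_sym j).
    by case: eqP => //= <-; rewrite eq_sym.
  have [->|it] := eqVneq i (top r).
    rewrite flipR xb xt /= andbC (eq_sym j).
    by case: eqP => //= <-.
  by rewrite flipD // andNb.
have D2 : points (flip x (bot r, top r)) :\: points x =
    [set (bot r, rgt r); (top r, lft r)].
  apply/setP=> -[i j]; rewrite !inE !in_points !xpair_eqE.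
  have [->|ib] := eqVneq i (bot r).
    rewrite flipL xb xt (negbTE bt) /= orbF andbC (eq_sym j).
    by case: eqP => //= <-.
  have [->|it] := eqVneq i (top r).
    rewrite flipR xb xt /= andbC (eq_sym j).
    by case: eqP => //= <-; rewrite eq_sym.
  by rewrite flipD // andNb.
rewrite D1 D2 cards2 xpair_eqE (negbTE bt) flipL flipR xb xt !eqxx !andbT /=.
by apply/eqP/setP => s; rewrite !inE -!orbA; do !bool_congr.
Qed.

Lemma legal_rectangle x (r : rectangle n) :
  x (bot r) = lft r -> x (top r) = rgt r ->
  legal x (bot r, top r) =
  [disjoint interior_points r & points x] && [disjoint squares_in r & gridX g].
Proof.
move=> xb xt; rewrite /legal /=.
have -> /= : bot r != top r by have /andP[] := valP r.
congr (_ && _).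
  apply/forallP/idP => [emp|].
    rewrite disjoints_subset; apply/subsetP => -[i j]; rewrite !inE /= in_points.
    apply: contraTneq => xij; subst j.
    by have := emp i; rewrite /= xb xt.
  move/disjointFr => dis i; rewrite /= xb xt; apply/negP => int.
  have := dis (i, x i); rewrite inE int in_points eqxx => /(_ isT); done.
apply/forall_inP/idP => [free|].
  rewrite disjoint_sym disjoints_subset; apply/subsetP => s /free.
  by rewrite /covers /= xb xt !inE.
move/disjointFl => dis s /dis; rewrite inE /covers /= xb xt => ->; done.
Qed.

Lemma dminus_genE x :
  dminus_gen g x = \sum_(p | legal x p) Oweight x p *: gen (flip x p).
Proof.
rewrite /dminus_gen (exchange_big_dep xpredT) //=.
(* A pair of equal rows gives no rectangle, hence the partial inverse. *)
pose rect p : option (rectangle n) := insub (p, (x p.1, x p.2)).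
pose ends (r : rectangle n) := (bot r, top r).
rewrite [RHS](reindex_omap ends rect); last first.
  move=> [a b] /and3P[/= ab _ _].
  by rewrite /rect insubT //= (inj_eq perm_inj) ab.
rewrite [RHS]big_mkcond; apply: eq_bigr => r _.
have -> : (rect (ends r) == Some r) =
    (x (bot r) == lft r) && (x (top r) == rgt r).
  rewrite /rect; case: insubP => [r' _ valr' | /=].
    transitivity (val r' == val r); first by rewrite (inj_eq val_inj).
    rewrite valr' /ends /=; case: (r) => -[[a b] [c d]] ?.
    by rewrite !xpair_eqE /bot /top /lft /rgt /= !eqxx.
  by rewrite (inj_eq perm_inj) andbb; case/andP: (valP r) => ->.
case: (altP (x (bot r) =P lft r)) => [xb|/negbTE xb]; last first.
  by rewrite /= andbF big_pred0 // => y; rewrite inE RectE xb.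
case: (altP (x (top r) =P rgt r)) => [xt|/negbTE xt]; last first.
  by rewrite /= andbF big_pred0 // => y; rewrite inE RectE xt andbF.
rewrite legal_rectangle // !andbT; case: ifP => dis; last first.
  by rewrite big_pred0 // => y; rewrite inE -andbA dis andbF.
rewrite (big_pred1 (flip x (ends r))) => [|y]; last first.
  by rewrite inE -andbA dis RectE xb xt !eqxx andbT.
congr (_ *: _); apply: eq_bigr => k _.
by rewrite /Ocount inE /covers /= xb xt.
Qed.

End Legal.

(** * Cancellation *)

Lemma big_involution (V : zmodType) (I : finType) (P : pred I) (F : I -> V)
    (f : I -> I) : (forall v : V, v + v = 0) ->
  (forall i, P i -> [/\ P (f i), f (f i) = i, f i != i & F (f i) = F i]) ->
  \sum_(i | P i) F i = 0.
Proof.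
move=> V2 fP.
(* Keep one element of each orbit apart by comparing ranks. *)
rewrite (bigID (fun i => enum_rank i < enum_rank (f i))%N) /=.
rewrite [X in _ + X](reindex_onto f f) => [|i /andP[/fP[]] //].
set S := \sum_(_ | _) _; rewrite -[RHS](V2 S); congr (_ + _).
apply: eq_big => [i|i /andP[/andP[Pfi _] /eqP ffi]]; last first.
  by have [_ _ _ <-] := fP _ Pfi; rewrite ffi.
apply/idP/idP => [/andP[/andP[Pfi le] /eqP ffi]|/andP[Pi lt]].
  have [Pi _ ne _] := fP _ Pfi; rewrite ffi in Pi ne le; rewrite Pi /=.
  rewrite ltn_neqAle leqNgt le andbT.
  by rewrite (inj_eq val_inj) (inj_eq enum_rank_inj).
have [Pfi ffi _ _] := fP _ Pi.
by rewrite Pfi ffi eqxx andbT /= -leqNgt ltnW.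
Qed.

Lemma Cminus_char2 n (v : Cminus n) : v + v = 0.
Proof.
rewrite -mulr2n -scaler_nat (_ : 2%:R = 0) ?scale0r //.
by rewrite -mpolyC_nat (_ : 2%:R = 0) ?mpolyC0 //; apply/val_inj.
Qed.

Lemma dminus_dminus_gen n (g : graph_grid n) (x : state n) : saturated g ->
  dminus g (dminus_gen g x) = 0.
Proof.
move=> sat; rewrite dminus_genE linear_sum /=.
under eq_bigr => p _ do
  rewrite linearZ /= dminus_on_gen dminus_genE scaler_sumr.
rewrite pair_big_dep /=.
apply: (big_involution (f := alternate x)) => [|q leg].
  exact: Cminus_char2.
have [[pq' [eqz eqD] alt neq] leg'] := alternate_legal sat leg.
split; [exact: leg'|exact: alt|exact: neq|].
rewrite !scalerA !Oweight2 -!/(flip2 _ _) eqz; congr (_ *: _).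
by apply: eq_bigr => k _; rewrite eqD.
Qed.

Theorem proposition4p9 (n : nat) (g : graph_grid n) (hg : saturated g) :
  dminus g \o dminus g =1 (fun _ : Cminus n => 0 : Cminus n).
Proof.
move=> c; rewrite /= {2}/dminus linear_sum big1 // => x _.
by rewrite linearZ /= dminus_dminus_gen // scaler0.
Qed.
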